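(* Every triangle-free graph $G$ with no induced subgraph isomorphic to $T_{123}$ is 8-colourable.
   Context: $T_{123}$ is the tree on vertices $a,b,c,d,e,f,g$ with edges $ab,ac,cd,ae,ef,fg$. *)

(* Defs.v *)
From HB Require Import structures.
From mathcomp Require Import all_boot.

Set Implicit Arguments.
Unset Strict Implicit.
Unset Printing Implicit Defensive.

Record sgraph := SGraph {
  svertex :> finType;
  sedge : rel svertex;
  sedge_sym : symmetric sedge;
  sedge_irr : irreflexive sedge
}.

Section Induced.
Variables (G : sgraph) (S : {set G}).

Definition induced_edge : rel {x : G | x \in S} :=
  fun u v => sedge (val u) (val v).

Lemma induced_edge_sym : symmetric induced_edge.
Proof. by move=> u v; apply: sedge_sym. Qed.

Lemma induced_edge_irr : irreflexive induced_edge.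
Proof. by move=> u; apply: sedge_irr. Qed.

Definition induced : sgraph := SGraph induced_edge_sym induced_edge_irr.
End Induced.

Definition isomorphic (G H : sgraph) : Prop :=
  exists2 f : G -> H, bijective f & forall x y, sedge (f x) (f y) = sedge x y.

Definition triangle_free (G : sgraph) : Prop :=
  forall x y z : G, ~ [/\ sedge x y, sedge y z & sedge x z].

Definition colourable (k : nat) (G : sgraph) : Prop :=
  exists c : G -> 'I_k, forall x y : G, sedge x y -> c x != c y.

(* The vertices a, b, c, d, e, f, g are numbered 0, 1, 2, 3, 4, 5, 6. *)
Definition T123_edges : seq (nat * nat) :=
  [:: (0, 1); (0, 2); (2, 3); (0, 4); (4, 5); (5, 6)].

Definition T123_edge : rel 'I_7 :=
  fun i j => ((i : nat, j : nat) \in T123_edges)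
          || ((j : nat, i : nat) \in T123_edges).

Lemma T123_edge_sym : symmetric T123_edge.
Proof. by move=> i j; rewrite /T123_edge orbC. Qed.

Lemma T123_edge_irr : irreflexive T123_edge.
Proof. by case; do 7 case=> //. Qed.

Definition T123 : sgraph := SGraph T123_edge_sym T123_edge_irr.

(* Main.v *)
(**
  Let L_0, L_1, ... be the distance levels from a set of roots in a component.
  Suppose that every vertex p of L_(k-1) with a neighbour in L_k starts an
  induced path p q1 q2 q3 with the q's at levels at most k-2. Then no q is
  adjacent to L_k, so p, q1, q2, q3 supply the long leg of a T_123 centred at p,
  or p, q1, q2 the long leg of one centred at a child x of p, while the two
  short legs are found inside L_k. Excluding these says exactly that the ends of
  a walk of length 3 in L_k are adjacent, so that L_k is a disjoint union of
  complete bipartite graphs. The hypothesis passes from k to k+1.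

  If the component has a 5-cycle, take it as the root set: the hypothesis holds
  for k = 2, L_0 is 3-colourable, and L_1 is covered by five neighbourhoods,
  which are stable. So 3 colours suffice on the even levels and 5 on the odd
  ones. Otherwise take as root a vertex v of maximum degree in the component:
  L_1 and L_2 are stable, and the hypothesis holds for k = 3, because a vertex p
  of L_2 with a neighbour in L_3 cannot be complete to N(v).
*)

Require Import Defs.
From mathcomp Require Import all_boot.
From mathcomp Require Import zify.

Set Implicit Arguments.
Unset Strict Implicit.
Unset Printing Implicit Defensive.

(** * Graphs closed under walks of length 3 *)

(** All neighbours of [x] share one neighbourhood, so comparing [N x] with it in a fixed order
    decides the side of [x]. *)
Lemma walk3_closed_bipartite (T : finType) (s : rel T) :
  symmetric s -> irreflexive s ->
  (forall x y z w, s x y -> s y z -> s z w -> s x w) ->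
  exists f : T -> bool, forall x y, s x y -> f x != f y.
Proof.
move=> sC sI s3; pose N x := [set z | s x z].
have N2 x y y' : s x y -> s x y' -> N y = N y'.
  move=> xy xy'; apply/setP=> z; rewrite !inE; apply/idP/idP.
    by apply: s3 xy; rewrite sC.
  by apply: s3 xy'; rewrite sC.
pose f x := if [pick y | s x y] is Some y
            then enum_rank (N x) < enum_rank (N y) else false.
have fE x y : s x y -> f x = (enum_rank (N x) < enum_rank (N y)).
  move=> xy; rewrite /f; case: pickP => [y' xy'|/(_ y)]; last by rewrite xy.
  by rewrite (N2 _ _ _ xy xy').
exists f => x y xy; have yx : s y x by rewrite sC.
rewrite (fE _ _ xy) (fE _ _ yx).
have NxNy : N x != N y.
  by apply/eqP=> /setP/(_ y); rewrite !inE xy sI.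
have : enum_rank (N x) != enum_rank (N y) by rewrite (inj_eq enum_rank_inj).
by rewrite -val_eqE /= neq_ltn; case: ltngtP.
Qed.

(** * Induced copies of the tree *)

Section Tripod.
Variable G : sgraph.
Local Notation e := (@sedge G).
Hypothesis triF : triangle_free G.
Hypothesis noT : forall S : {set G}, ~ isomorphic (induced S) T123.

Lemma edgeC (x y : G) : e x y -> e y x.
Proof. by rewrite sedge_sym. Qed.

Lemma edge_common_nbr (x y z : G) : e x y -> e x z -> e y z = false.
Proof. by move=> xy xz; apply/negP=> yz; apply: (triF (And3 xy yz xz)). Qed.

Lemma T123_embedding_free (f : 'I_7 -> G) :
  ~ (forall i j, e (f i) (f j) = T123_edge i j).
Proof.
move=> fE; have f_inj : injective f.
  move=> i j fij; apply/eqP/negPn/negP.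
  have nbrs k : T123_edge i k = T123_edge j k by rewrite -!fE fij.
  (* The vertices of T123 have pairwise distinct neighbourhoods. *)
  have : all (fun k =>
      (((i : nat, k) \in T123_edges) || ((k, i : nat) \in T123_edges))
      == (((j : nat, k) \in T123_edges) || ((k, j : nat) \in T123_edges)))
      (iota 0 7).
    apply/allP=> k; rewrite mem_iota /= => k7.
    by have := nbrs (inord k); rewrite /T123_edge inordK // => ->.
  by case: i j {fij nbrs} => [] [|[|[|[|[|[|[|i]]]]]]] // ? [] [|[|[|[|[|[|[|j]]]]]]].
set S := f @: setT; apply: (noT (S := S)).
have fS (i : 'I_7) : f i \in S by apply: imset_f.
have /fin_all_exists[g gK] (x : induced S) : exists i, f i = val x.
  by have /imsetP[i _ ->] := valP x; exists i.
exists g; last by move=> x y; rewrite /sedge /= /induced_edge -fE !gK.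
exists (fun i => exist _ (f i) (fS i)) => [x|i].
  by apply: val_inj; apply: gK.
by apply: f_inj; rewrite gK.
Qed.

(** The centre is [a], the legs are [b], [c d] and [p q r]. Nine non-edges are assumed; the other
    six join vertices at distance two in the tree and follow from triangle-freeness. *)
Lemma tripod_free (a b c d p q r : G) :
  e a b -> e a c -> e c d -> e a p -> e p q -> e q r ->
  ~~ e b d -> ~~ e d p -> ~~ e a r ->
  (forall x, x \in [:: b; c; d] -> ~~ e x q && ~~ e x r) -> False.
Proof.
move=> ab ac cd ap pq qr /negPf bd /negPf dp /negPf ar away.
have [/andP[/negPf bq /negPf br] /andP[/negPf cq /negPf cr]] :
  (~~ e b q && ~~ e b r) /\ (~~ e c q && ~~ e c r).
  by split; apply: away; rewrite !inE eqxx ?orbT.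
have /andP[/negPf dq /negPf dr] : ~~ e d q && ~~ e d r.
  by apply: away; rewrite !inE eqxx ?orbT.
have ad := edge_common_nbr (edgeC ac) cd.
have bc := edge_common_nbr ab ac.
have bp := edge_common_nbr ab ap.
have cp := edge_common_nbr ac ap.
have aq := edge_common_nbr (edgeC ap) pq.
have pr := edge_common_nbr (edgeC pq) qr.
have Ir := @sedge_irr G.
apply: (@T123_embedding_free (fun i => nth a [:: a; b; c; d; p; q; r] i)).
move=> [] [|[|[|[|[|[|[|i]]]]]]] // ? [] [|[|[|[|[|[|[|j]]]]]]] // ? /=;
by rewrite /T123_edge /= ?Ir ?(ab, ac, cd, ap, pq, qr, bd, dp, aq, ar, pr,
   bq, cq, dq, br, cr, dr, ad, bc, bp, cp) // sedge_sym
   ?(ab, ac, cd, ap, pq, qr, bd, dp, aq, ar, pr,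
   bq, cq, dq, br, cr, dr, ad, bc, bp, cp).
Qed.

(** * Levels and tails *)

Definition levelling (C : pred G) (d : G -> nat) : Prop :=
  [/\ forall x y, e x y -> C x = C y,
      forall x y, C x -> e x y -> d y <= (d x).+1 &
      forall x k, C x -> d x = k.+1 -> exists2 p, e p x & d p = k].

Definition has_tail (d : G -> nat) (k : nat) (p : G) : Prop :=
  exists q1 q2 q3, [/\ e p q1, e q1 q2, e q2 q3, ~~ e p q3 &
                       [/\ d q1 <= k, d q2 <= k & d q3 <= k]].

(** The index [k] serves level [k.+2]: tails at levels at most [k] have no neighbour there. *)
Definition level_tails (C : pred G) (d : G -> nat) (k : nat) : Prop :=
  forall p x, C x -> e p x -> d p = k.+1 -> d x = k.+2 -> has_tail d k p.

Section Levels.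
Variables (C : pred G) (d : G -> nat).
Hypothesis lev : levelling C d.

Lemma level_gap (x y : G) : C x -> (d x).+1 < d y -> ~~ e x y.
Proof.
by case: lev => _ step _ Cx xy; apply/negP=> /(step _ _ Cx); rewrite leqNgt xy.
Qed.

(** Put a parent [p'] of [p] in front of the tail of [p'] and drop [q3]; the levels of [p] and [q2]
    differ by at least two. *)
Lemma level_tailsS (k : nat) : level_tails C d k -> level_tails C d k.+1.
Proof.
have [closed step parent] := lev.
move=> tk p x Cx px dp dx; have Cp : C p by rewrite (closed _ _ px).
have [p' p'p dp'] := parent _ _ Cp dp.
have [q1 [q2 [q3 [pq1 q12 _ _ [d1 d2 _]]]]] := tk _ _ Cp p'p dp' dp.
have Cq2 : C q2 by rewrite -(closed _ _ q12) -(closed _ _ pq1) (closed _ _ p'p).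
exists p', q1, q2; split=> //; first exact: edgeC.
  by rewrite sedge_sym level_gap // dp ltnS.
by split; lia.
Qed.

Lemma level_tails_leq (k m : nat) : k <= m -> level_tails C d k -> level_tails C d m.
Proof.
move=> /subnK <-; elim: (m - k) => // i IH tk.
by rewrite addSn; apply: level_tailsS; apply: IH.
Qed.

(** Otherwise [p] is the centre of a tree with legs [y], [x z] and [q1 q2 q3]. *)
Lemma level_siblings_twins (k : nat) (p x y z : G) :
  level_tails C d k -> C x -> d p = k.+1 -> d x = k.+2 -> d y = k.+2 ->
  d z = k.+2 -> e p x -> e p y -> e x z -> e y z.
Proof.
have [closed _ _] := lev.
move=> tk Cx dp dx dy dz px py xz; apply/negPn/negP=> yz.
have [q1 [q2 [q3 [pq1 q12 q23 pq3 [d1 d2 d3]]]]] := tk _ _ Cx px dp dx.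
have Cq1 : C q1 by rewrite -(closed _ _ pq1) (closed _ _ px).
have Cq2 : C q2 by rewrite -(closed _ _ q12).
have Cq3 : C q3 by rewrite -(closed _ _ q23).
apply: (tripod_free py px xz pq1 q12 q23 yz _ pq3).
  by rewrite sedge_sym level_gap // dz !ltnS.
move=> w w_in; have dw : d w = k.+2.
  by move: w_in; rewrite !inE => /or3P[] /eqP->.
by rewrite ![e w _]sedge_sym !level_gap // dw !ltnS.
Qed.

(** Otherwise [x] is the centre of a tree with legs [y1], [y2 z] and [p q1 q2], where [p] is a
    parent of [x]. *)
Lemma level_walk3 (k : nat) (y1 x y2 z : G) :
  level_tails C d k -> C x -> d y1 = k.+2 -> d x = k.+2 -> d y2 = k.+2 ->
  d z = k.+2 -> e y1 x -> e x y2 -> e y2 z -> e y1 z.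
Proof.
have [closed _ parent] := lev.
move=> tk Cx dy1 dx dy2 dz y1x xy2 y2z; apply/negPn/negP=> y1z.
have [p px dp] := parent _ _ Cx dx.
have xy1 := edgeC y1x.
(* If [p] were adjacent to [z], the siblings [x] and [z] would both be adjacent to [y1]. *)
have pz : ~~ e p z.
  apply: contra y1z => pz; apply: edgeC.
  exact: (level_siblings_twins tk Cx dp dx dz dy1 px pz).
have [q1 [q2 [q3 [pq1 q12 q23 pq3 [d1 d2 d3]]]]] := tk _ _ Cx px dp dx.
have Cq1 : C q1 by rewrite -(closed _ _ pq1) (closed _ _ px).
have Cq2 : C q2 by rewrite -(closed _ _ q12).
apply: (tripod_free xy1 xy2 y2z (edgeC px) pq1 q12 y1z).
- by rewrite sedge_sym.
- by rewrite sedge_sym level_gap // dx !ltnS.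
move=> w w_in; have dw : d w = k.+2.
  by move: w_in; rewrite !inE => /or3P[] /eqP->.
by rewrite ![e w _]sedge_sym !level_gap // dw !ltnS.
Qed.

(** Tails are requested only for levels that contain an edge, so a stable level 2 makes the case
    [k = 0] vacuous. *)
Lemma upper_levels_bipartite :
  (forall k x y, C x -> d x = k.+2 -> d y = k.+2 -> e x y -> level_tails C d k) ->
  exists f : G -> bool, forall x y,
    C x -> 1 < d x -> d x = d y -> e x y -> f x != f y.
Proof.
have [closed _ _] := lev => tails.
pose s x y := [&& C x, 1 < d x, d x == d y & e x y].
have [|||f fP] := @walk3_closed_bipartite G s.
- move=> x y; rewrite /s sedge_sym; case: (boolP (e y x)) => [/closed->|_].
    by rewrite eq_sym; case: eqP => [->|]; rewrite ?andbF.
  by rewrite !andbF.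
- by move=> x; rewrite /s sedge_irr !andbF.
- move=> x y z w /and4P[Cx dx /eqP xy exy] /and4P[Cy _ /eqP yz eyz].
  move=> /and4P[_ _ /eqP zw ezw]; rewrite /s Cx dx xy yz zw eqxx /=.
  have [k kE] : exists k, d x = k.+2 by exists (d x).-2; move: dx; lia.
  have [ky kz kw] : [/\ d y = k.+2, d z = k.+2 & d w = k.+2] by split; congruence.
  exact: (level_walk3 (tails _ _ _ Cx kE ky exy) Cy kE ky kz kw exy eyz ezw).
exists f => x y Cx dx xy exy; apply: fP.
by rewrite /s Cx dx xy eqxx.
Qed.

(** Even levels use the colours 0 to 2, odd levels 3 to 7. Adjacent vertices lie on the same level
    or on levels of different parity. *)
Lemma levelling_colour8 (f0 f1 : G -> nat) (f : G -> bool) :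
  (forall x, f0 x < 3) -> (forall x, f1 x < 5) ->
  (forall x y, C x -> d x = 0 -> d y = 0 -> e x y -> f0 x != f0 y) ->
  (forall x y, C x -> d x = 1 -> d y = 1 -> e x y -> f1 x != f1 y) ->
  (forall x y, C x -> 1 < d x -> d x = d y -> e x y -> f x != f y) ->
  exists c : G -> 'I_8, forall x y, C x -> e x y -> c x != c y.
Proof.
have [closed step _] := lev => lt0 lt1 ok0 ok1 ok.
pose h x : nat := match d x with 0 => f0 x | 1 => f1 x | _ => f x : nat end.
pose c x := if odd (d x) then h x + 3 else h x.
have hodd x : odd (d x) -> h x < 5.
  by rewrite /h; case: (d x) => [|[|k]] // _; case: (f x).
have heven x : ~~ odd (d x) -> h x < 3.
  by rewrite /h; case: (d x) => [|[|k]] // _; case: (f x).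
have hP x y : C x -> d x = d y -> e x y -> h x != h y.
  move=> Cx xy exy; rewrite /h -xy; case dx: (d x) => [|[|k]].
  - by apply: ok0; rewrite -?xy.
  - by apply: ok1; rewrite -?xy.
  - by have := ok _ _ Cx _ xy exy; rewrite dx => /(_ isT); case: (f x) (f y) => [] [].
have c8 x : c x < 8.
  rewrite /c; case: ifPn => [/hodd|/heven]; first by lia.
  by move/leq_trans; apply.
exists (fun x => Ordinal (c8 x)) => x y Cx xy; rewrite -val_eqE /= /c.
have Cy : C y by rewrite -(closed _ _ xy).
have le1 := step _ _ Cx xy; have le2 := step _ _ Cy (edgeC xy).
case: ifPn => dx; case: ifPn => dy.
- by rewrite eqn_add2r; apply: hP => //; lia.
- by have := heven _ dy; lia.
- by have := heven _ dx; lia.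
- by apply: hP => //; lia.
Qed.

End Levels.

(** * Distance from a set of roots *)

Fixpoint ball (R : {set G}) (n : nat) : {set G} :=
  if n is m.+1 then ball R m :|: [set y | [exists x in ball R m, e x y]] else R.

Lemma ballS_edge (R : {set G}) (n : nat) (x y : G) :
  x \in ball R n -> e x y -> y \in ball R n.+1.
Proof.
by move=> xn xy; rewrite /= !inE; apply/orP; right; apply/existsP; exists x; rewrite xn.
Qed.

Lemma exists_levelling (C : pred G) (R : {set G}) :
  (forall x y, e x y -> C x = C y) ->
  (forall x, C x -> exists2 r, r \in R & connect e r x) ->
  exists2 d, levelling C d & forall x, C x -> (d x == 0) = (x \in R).
Proof.
move=> closed reach.
have in_ball p : forall u n, u \in ball R n -> path e u p ->
    last u p \in ball R (n + size p).
  elim: p => [|w p IH] u n un /=; first by rewrite addn0.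
  by case/andP=> uw wp; rewrite addnS -addSn; apply: IH => //; apply: ballS_edge uw.
(* On [C], the level is the least radius of a ball containing [x]; elsewhere it defaults to 0. *)
have /fin_all_exists[d dP] (x : G) : exists n, C x ->
    x \in ball R n /\ forall m, x \in ball R m -> n <= m.
  case: (boolP (C x)) => [Cx|_]; last by exists 0.
  have [r rR /connectP[p rp xE]] := reach _ Cx.
  have ex : exists n, x \in ball R n.
    by exists (0 + size p); rewrite xE; apply: in_ball.
  by case: (ex_minnP ex) => n xn nmin; exists n.
have step x y : C x -> e x y -> d y <= (d x).+1.
  move=> Cx xy; have Cy : C y by rewrite -(closed _ _ xy).
  by apply: (dP y Cy).2; apply: ballS_edge xy; apply: (dP x Cx).1.
exists d; last first.
  move=> x Cx; have [xd dmin] := dP _ Cx; apply/eqP/idP=> [d0|xR].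
    by rewrite d0 in xd.
  by apply/eqP; rewrite -leqn0; apply: dmin.
split=> // x k Cx dx; have [xd dmin] := dP _ Cx.
move: xd; rewrite dx /= inE => /orP[/dmin|]; first by rewrite dx ltnn.
rewrite inE => /existsP[p /andP[pk px]]; exists p => //.
have Cp : C p by rewrite (closed _ _ px).
by apply/eqP; rewrite eqn_leq (dP p Cp).2 // -ltnS -dx step.
Qed.

Lemma connect_edge (r x y : G) : e x y -> connect e r x = connect e r y.
Proof.
move=> xy; apply/idP/idP=> h; apply: connect_trans h (connect1 _) => //.
exact: edgeC.
Qed.

(** * Components with a 5-cycle *)

(** The tail is [c0 c1 c2] unless [p] is adjacent to [c2]. Then [c2 c3 c4] serves, since [p] and
    [c4] have the common neighbour [c0]. *)
Lemma C5_tail (d : G -> nat) (p c0 c1 c2 c3 c4 : G) :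
  e c0 c1 -> e c1 c2 -> e c2 c3 -> e c3 c4 -> e c4 c0 -> e p c0 ->
  (forall x, x \in [:: c0; c1; c2; c3; c4] -> d x = 0) -> has_tail d 0 p.
Proof.
move=> e01 e12 e23 e34 e40 p0 d0.
have [/d0 d_0 /d0 d_1 /d0 d_2 /d0 d_3 /d0 d_4] :
    let c := [:: c0; c1; c2; c3; c4] in
    [/\ c0 \in c, c1 \in c, c2 \in c, c3 \in c & c4 \in c].
  by rewrite /= !inE !eqxx !orbT.
case: (boolP (e p c2)) => p2; [exists c2, c3, c4 | exists c0, c1, c2].
  rewrite d_2 d_3 d_4; split=> //; rewrite sedge_sym.
  by rewrite (edge_common_nbr (edgeC e40)) // edgeC.
by rewrite d_0 d_1 d_2.
Qed.

Lemma component_colour8_C5 (r c0 c1 c2 c3 c4 : G) :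
  e c0 c1 -> e c1 c2 -> e c2 c3 -> e c3 c4 -> e c4 c0 -> connect e r c0 ->
  exists c : G -> 'I_8, forall x y, connect e r x -> e x y -> c x != c y.
Proof.
move=> e01 e12 e23 e34 e40 rc0.
pose H := [:: c0; c1; c2; c3; c4]; pose R := [set x in H].
have [||d lev dR] := @exists_levelling (connect e r) R.
- by move=> x y; apply: connect_edge.
- move=> x rx; exists c0; first by rewrite !inE eqxx.
  by apply: connect_trans rx; rewrite (sym_connect_sym (@sedge_sym G)).
have [closed _ parent] := lev.
have rc1 : connect e r c1 by rewrite -(closed _ _ e01).
have rc2 : connect e r c2 by rewrite -(closed _ _ e12).
have rc3 : connect e r c3 by rewrite -(closed _ _ e23).
have rc4 : connect e r c4 by rewrite -(closed _ _ e34).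
have H0 x : x \in H -> d x = 0.
  move=> xH; apply/eqP; rewrite dR ?in_set //.
  by move: xH; rewrite !inE => /or4P[| | |/orP[]] /eqP->.
have parentH x : connect e r x -> d x = 1 -> exists2 p, p \in H & e p x.
  move=> rx dx; have [p px /eqP dp] := parent _ _ rx dx; exists p => //.
  by move: dp; rewrite dR ?in_set // (closed _ _ px).
have tail0 : level_tails (connect e r) d 0.
  move=> p x rx px dp _; have rp : connect e r p by rewrite (closed _ _ px).
  (* The cycle is rotated so that the neighbour of [p] comes first. *)
  have [c cH /edgeC pc] := parentH _ rp dp.
  by move: cH pc; rewrite !inE => /or4P[| | |/orP[]] /eqP-> pc;
    [ apply: (C5_tail e01 e12 e23 e34 e40 pc) | apply: (C5_tail e12 e23 e34 e40 e01 pc)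
    | apply: (C5_tail e23 e34 e40 e01 e12 pc) | apply: (C5_tail e34 e40 e01 e12 e23 pc)
    | apply: (C5_tail e40 e01 e12 e23 e34 pc)];
    move=> z zH; apply: H0; move: zH; rewrite !inE;
    do ![case/orP] => ->; rewrite ?orbT.
have [|f fP] := upper_levels_bipartite lev.
  by move=> k x y _ _ _ _; apply: (level_tails_leq lev (leq0n k)).
(* On the cycle, [f0] has the classes {c0, c2}, {c1, c3} and {c4}. On level 1, [f1] records the
   first cycle vertex adjacent to [x]. *)
pose f0 x := if (x == c0) || (x == c2) then 0 else
             if (x == c1) || (x == c3) then 1 else 2.
pose f1 x := if e c0 x then 0 else if e c1 x then 1 else
             if e c2 x then 2 else if e c3 x then 3 else 4.
apply: (levelling_colour8 lev (f0 := f0) (f1 := f1) _ _ _ _ fP).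
- by move=> x; rewrite /f0; do ![case: ifP => _].
- by move=> x; rewrite /f1; do ![case: ifP => _].
- move=> x y rx /eqP; rewrite dR // in_set => xH /eqP.
  have ry := connect_trans rx (connect1 _).
  move=> dy xy; move: dy; rewrite dR ?(ry y) // in_set => yH.
  have e02 := edge_common_nbr (edgeC e01) e12.
  have e13 := edge_common_nbr (edgeC e12) e23.
  have Ir := @sedge_irr G.
  have pairF a b : e a b = false -> (x == a) || (x == b) ->
      (y == a) || (y == b) -> False.
    move=> ab; move: xy => /[swap] /orP[] /eqP-> /[swap] /orP[] /eqP->;
    by rewrite ?Ir ?ab // sedge_sym ab.
  rewrite /f0; case x02: ((x == _) || _); case y02: ((y == _) || _).
  - by case: (pairF _ _ e02).
  - by case: ifP.
  - by case: ifP.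
  case x13: ((x == _) || _); case y13: ((y == _) || _) => //.
    by case: (pairF _ _ e13).
  move/norP: (negbT x02) => [/negPf x0 /negPf x2].
  move/norP: (negbT y02) => [/negPf y0 /negPf y2].
  move/norP: (negbT x13) => [/negPf x1 /negPf x3].
  move/norP: (negbT y13) => [/negPf y1 /negPf y3].
  move: xH yH; rewrite !inE x0 x1 x2 x3 y0 y1 y2 y3 /= => x4 y4.
  by case: (pairF c4 c4); rewrite ?Ir ?x4 ?y4.
- move=> x y rx dx dy xy.
  have [c cH cx] := parentH _ rx dx.
  have rcy : connect e r y by rewrite -(closed _ _ xy).
  have [c' c'H cy] := parentH _ rcy dy.
  have nc z : e z x -> e z y = false.
    by move=> zx; apply/negP=> /edgeC yz; rewrite (edge_common_nbr xy (edgeC zx)) in yz.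
  (* On level 1 the default colour 4 thus means adjacency to [c4]. *)
  have last4 z : (exists2 c, c \in H & e c z) -> e c0 z = false ->
      e c1 z = false -> e c2 z = false -> e c3 z = false -> e c4 z.
    move=> [u uH uz] z0 z1 z2 z3; move: uH uz; rewrite !inE.
    by move=> /or4P[| | |/orP[]] /eqP->; rewrite ?z0 ?z1 ?z2 ?z3.
  rewrite /f1; case x0: (e c0 x); first by rewrite nc //; do ![case: ifP => _].
  case y0: (e c0 y); first by do ![case: ifP => _].
  case x1: (e c1 x); first by rewrite nc //; do ![case: ifP => _].
  case y1: (e c1 y); first by do ![case: ifP => _].
  case x2: (e c2 x); first by rewrite nc //; do ![case: ifP => _].
  case y2: (e c2 y); first by do ![case: ifP => _].
  case x3: (e c3 x); first by rewrite nc.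
  case y3: (e c3 y); first by [].
  have x4 := last4 x (ex_intro2 _ _ c cH cx) x0 x1 x2 x3.
  have := last4 y (ex_intro2 _ _ c' c'H cy) y0 y1 y2 y3.
  by rewrite nc.
Qed.

(** * Rooting at a vertex of maximum degree *)

Lemma component_colour8 (v : G) :
  (forall u, connect e v u -> #|[set x | e u x]| <= #|[set x | e v x]|) ->
  exists c : G -> 'I_8, forall x y, connect e v x -> e x y -> c x != c y.
Proof.
move=> vmax.
have [||d lev dR] := @exists_levelling (connect e v) [set v].
- by move=> x y; apply: connect_edge.
- by move=> x vx; exists v; rewrite ?inE.
have [closed step parent] := lev.
have d0E x : connect e v x -> d x = 0 -> x = v.
  by move=> vx /eqP; rewrite dR // inE => /eqP.
have dv : d v = 0 by apply/eqP; rewrite dR ?inE.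
have d1E x : connect e v x -> d x = 1 -> e v x.
  move=> vx dx; have [p px dp] := parent _ _ vx dx.
  by rewrite -(d0E p) // (closed _ _ px).
case: (boolP [exists x, exists y, [&& connect e v x, d x == 2, d y == 2 & e x y]]).
  (* An edge inside level 2, parents of its ends and [v] form a 5-cycle. *)
  case/existsP=> x /existsP[y /and4P[vx /eqP dx /eqP dy xy]].
  have vy : connect e v y by rewrite -(closed _ _ xy).
  have [p px dp] := parent _ _ vx dx; have [q qy dq] := parent _ _ vy dy.
  apply: (@component_colour8_C5 v v p x y q) => //.
  - by apply: d1E; rewrite // (closed _ _ px).
  - exact: edgeC.
  - by apply/edgeC/d1E; rewrite // (closed _ _ qy).
move/existsPn=> noL2.
have tail1 : level_tails (connect e v) d 1.
  move=> p x vx px dp dx; have vp : connect e v p by rewrite (closed _ _ px).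
  have [p' p'p dp'] := parent _ _ vp dp.
  have vp' : connect e v p' by rewrite (closed _ _ p'p).
  have vep' := d1E _ vp' dp'.
  (* Otherwise N(v) and [x] lie in N(p), and [p] has larger degree than [v]. *)
  have [w vw pw] : exists2 w, e v w & ~~ e p w.
    have [/existsP[w /andP[]]|/existsPn sub] := boolP [exists w, e v w && ~~ e p w].
      by exists w.
    have := vmax _ vp; rewrite leqNgt => /negP[]; apply: proper_card.
    apply/properP; split.
      apply/subsetP=> w; rewrite !inE => vw.
      by have := sub w; rewrite vw negbK.
    exists x; rewrite !inE //; apply/negP=> vx'.
    by have := step _ _ (connect0 _ _) vx'; rewrite dv dx.
  exists p', v, w; split=> //; [exact: edgeC|exact: edgeC|].
  by have := step _ _ (connect0 _ _) vw; rewrite dp' dv.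
have [|f fP] := upper_levels_bipartite lev.
  move=> [|k] x y vx dx dy xy; last exact: (level_tails_leq lev _ tail1).
  by have /existsPn/(_ y) := noL2 x; rewrite vx dx dy xy.
(* Level 0 is [v] alone and level 1 lies in its neighbourhood; both are stable, so constants
   suffice. *)
apply: (levelling_colour8 lev (f0 := fun=> 0) (f1 := fun=> 0) _ _ _ _ fP) => //.
- move=> x y vx dx dy xy; have vy : connect e v y by rewrite -(closed _ _ xy).
  by move: xy; rewrite (d0E x) // (d0E y) // sedge_irr.
- move=> x y vx dx dy xy; have vy : connect e v y by rewrite -(closed _ _ xy).
  by rewrite (edge_common_nbr (d1E _ vx dx) (d1E _ vy dy)) in xy.
Qed.

End Tripod.

(** * Gluing the components *)

Theorem mainTheorem8 (G : sgraph)
  (hG : triangle_free G)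
  (hT : forall S : {set G}, ~ isomorphic (induced S) T123) :
  colourable 8 G.
Proof.
have csym := sym_connect_sym (@sedge_sym G).
have /fin_all_exists[c cP] (r : G) : exists c : G -> 'I_8,
    forall x y, connect (@sedge G) r x -> sedge x y -> c x != c y.
  case: (@arg_maxnP G r (connect (@sedge G) r) (fun u => #|[set x | sedge u x]|)).
    exact: connect0.
  move=> v rv vmax; have [|c cP] := component_colour8 hG hT (v := v).
    by move=> u vu; apply: vmax; apply: connect_trans rv vu.
  exists c => x y rx; apply: cP; apply: connect_trans rx.
  by rewrite csym.
(* The canonical root of a component selects its colouring, so adjacent vertices use the same
   one. *)
exists (fun x => c (root (@sedge G) x) x) => x y xy.
have /(rootP csym) <- : connect (@sedge G) x y by apply: connect1.
by apply: cP; rewrite // csym connect_root.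
Qed.
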